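(* If $n>3$ and $r\ge 6$, or $n>7$ and $r>3$, then $\dim V_P>\dim N^r_n$.
   Context: $k$ is an algebraically closed field, $G=GL_n(k)$, and $G$ acts on $\mathfrak{gl}_n$ (the $n\times n$ matrices over $k$) by conjugation and on $(\mathfrak{gl}_n)^r$ by simultaneous conjugation; $n,r$ are integers. $\mathcal{N}_n\subset\mathfrak{gl}_n$ is the variety of nilpotent matrices and $C_r(\mathcal{N}_n)=\{(v_1,\ldots,v_r)\in(\mathcal{N}_n)^r : [v_i,v_j]=0 \text{ for all } i,j\}$. A nilpotent matrix is regular if it is conjugate to the single $n\times n$ nilpotent Jordan block. $N^r_n$ denotes the Zariski closure of the set of tuples in $C_r(\mathcal{N}_n)$ whose first matrix is regular. $P$ is the parabolic subgroup of $G$ corresponding to the partition $[m,m]$ if $n=2m$, or $[m+1,m]$ if $n=2m+1$, and $\mathfrak{u}_P$ is the Lie algebra of its unipotent radical: explicitly, the space of all block matrices $\begin{pmatrix} 0 & 0 \\ A & 0 \end{pmatrix}$ where $A$ is an arbitrary $m\times m$ matrix if $n=2m$, or an arbitrary $m\times(m+1)$ matrix if $n=2m+1$. $V_P=G\cdot\mathfrak{u}_P^r=\{(gu_1g^{-1},\ldots,gu_rg^{-1}) : g\in G,\ u_i\in\mathfrak{u}_P\}$, a Zariski-closed subvariety of $(\mathfrak{gl}_n)^r$. *)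

(* Defs.v *)
From mathcomp Require Import all_boot all_order all_algebra.
From mathcomp Require Import boolp classical_sets.
From mathcomp Require Import mpoly.

Set Implicit Arguments.
Unset Strict Implicit.
Unset Printing Implicit Defensive.

Import GRing.Theory.

Local Open Scope ring_scope.
Local Open Scope classical_set_scope.

Definition mxtuple (k : closedFieldType) (n r : nat) : Type :=
  {ffun 'I_r -> 'M[k]_n}.

Section Zariski.
Context (k : closedFieldType) (n r : nat).
Implicit Types (v : mxtuple k n r) (A B X Z : set (mxtuple k n r)).

(* The r * n * n matrix entries of v; they identify (gl_n)^r with the affine
   space of dimension r * (n * n). *)
Definition mxcoord v : 'I_(r * (n * n)) -> k :=
  fun j => mxvec (\matrix_(i < r) mxvec (v i)) 0 j.

Definition zariski_closed Z : Prop :=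
  exists S : set {mpoly k[r * (n * n)]},
    Z = [set v | forall p, S p -> p.@[mxcoord v] = 0].

Definition zariski_closure X : set (mxtuple k n r) :=
  \bigcap_(Z in [set Z | zariski_closed Z /\ X `<=` Z]) Z.

Definition zariski_irreducible Z : Prop :=
  Z !=set0 /\
  forall A B, zariski_closed A -> zariski_closed B ->
    Z `<=` A `|` B -> Z `<=` A \/ Z `<=` B.

Definition closed_in X Z : Prop := exists2 A, zariski_closed A & Z = X `&` A.

Definition irreducible_chain X (d : nat) : Prop :=
  exists Z : nat -> set (mxtuple k n r),
    (forall i, (i <= d)%N -> closed_in X (Z i) /\ zariski_irreducible (Z i)) /\
    (forall i, (i < d)%N -> Z i `<` Z i.+1).

(* krull_dim X d: the dimension of X, as a topological space with the topology
   induced by the Zariski topology, is the natural number d. *)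
Definition krull_dim X (d : nat) : Prop :=
  irreducible_chain X d /\ forall e, irreducible_chain X e -> (e <= d)%N.

End Zariski.

Section Varieties.
Context (k : closedFieldType) (n r : nat).

Definition nilpotent_mx (A : 'M[k]_n) : Prop := exists d : nat, A ^+ d = 0.

Definition jordan_block : 'M[k]_n := \matrix_(i, j) (j == i.+1 :> nat)%:R.

Definition regular_nilpotent (A : 'M[k]_n) : Prop :=
  exists2 g : 'M[k]_n, g \in unitmx & A = g *m jordan_block *m invmx g.

Definition commuting_nilpotent : set (mxtuple k n r) :=
  [set v | (forall i, nilpotent_mx (v i)) /\
           (forall i j, v i *m v j - v j *m v i = 0)].

(* The first matrix of v is the one of index 0. *)
Definition regular_closure : set (mxtuple k n r) :=
  zariski_closure
    [set v | commuting_nilpotent v /\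
             exists2 i : 'I_r, i = 0%N :> nat & regular_nilpotent (v i)].

(* With m = n./2, the lower left block consists of the last m rows and of the
   first n - m columns; n - m is m when n = 2m, and m + 1 when n = 2m + 1. *)
Definition u_P : set 'M[k]_n :=
  [set u | forall i j : 'I_n,
     ~~ ((n - n./2 <= i)%N && (j < n - n./2)%N) -> u i j = 0].

Definition V_P : set (mxtuple k n r) :=
  [set v | exists2 g : 'M[k]_n, g \in unitmx &
           exists2 u : mxtuple k n r, (forall i, u_P (u i)) &
           forall i, v i = g *m u i *m invmx g].

End Varieties.

Arguments regular_closure : clear implicits.
Arguments V_P : clear implicits.

(* Main.v *)
(* Upper bound.  Given a chain Z_0 < .. < Z_e of irreducible closed sets, choose
   f_i vanishing on Z_i but not on Z_(i+1); by induction on e the monomials in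
   the f_i are linearly independent on Z_e.  If Z_e lies in the closure of the
   image of a rational map in D parameters, clearing denominators turns the
   (s+1)^e monomials of partial degrees at most s into polynomials of degree O(s)
   in D variables, so that e <= D by counting dimensions.
   A regular nilpotent matrix is g J g^-1, where the freedom of g up to k[J]
   allows its last column to be a standard basis vector, and the matrices
   commuting with it are the conjugates of the Toeplitz matrices k[J]: this
   parametrizes N^r_n by n(n-1) + (r-1)(n-1) parameters.
   Lower bound.  Conjugating u_P^r by the opposite unipotent group is an
   injective map on a dense open subset of an affine space of dimension
   m(n-m)(r+1); a suitable coordinate flag in that space has as its images the
   terms of a strict chain of irreducible sets in V_P. *)

Require Import Defs.
From mathcomp Require Import all_boot all_order all_algebra.
From mathcomp Require Import boolp classical_sets mpoly.
From mathcomp Require Import zify ring.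

Set Implicit Arguments.
Unset Strict Implicit.
Unset Printing Implicit Defensive.

Import GRing.Theory.

Local Open Scope ring_scope.
Local Open Scope classical_set_scope.

Lemma msizeM_leS (R : idomainType) D (p q : {mpoly R[D]}) a b :
  (msize p <= a.+1)%N -> (msize q <= b.+1)%N -> (msize (p * q) <= (a + b).+1)%N.
Proof.
have [->|p0] := eqVneq p 0; first by rewrite mul0r msize0.
have [->|q0] := eqVneq q 0; first by rewrite mulr0 msize0.
by rewrite msizeM //; move: (msize p) (msize q) => u w; lia.
Qed.

Lemma mnm_le_mdeg D (m : 'X_{1..D}) i : (m i <= mdeg m)%N.
Proof. by rewrite mdegE (bigD1 i) //= leq_addr. Qed.

(** * Zariski closure and irreducibility in terms of vanishing polynomials *)

Section Vanishing.
Context (k : closedFieldType) (n r : nat).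
Local Notation point := (mxtuple k n r).
Local Notation poly_on := {mpoly k[r * (n * n)]}.
Implicit Types (p q : poly_on) (v : point) (X Z : set point).

Definition vanishes p Z : Prop := forall v, Z v -> p.@[mxcoord v] = 0.

Lemma not_vanishes p Z :
  ~ vanishes p Z -> exists2 v, Z v & p.@[mxcoord v] != 0.
Proof.
move=> hp; apply: contrapT => hv; apply: hp => v Zv.
by apply: contrapT => /eqP hpv; apply: hv; exists v.
Qed.

Lemma zariski_closureP X v :
  zariski_closure X v <-> forall p, vanishes p X -> p.@[mxcoord v] = 0.
Proof.
split=> [hv p pX | hv Z /= [[S ->] XS] p Sp].
  apply: (hv [set w | p.@[mxcoord w] = 0]); split => //.
  exists [set p]; apply/seteqP; split=> w /=; first by move=> pw q ->.
  by apply.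
by apply: hv => w /XS; apply.
Qed.

Lemma vanishes_closure p X : vanishes p X -> vanishes p (zariski_closure X).
Proof. by move=> pX v /zariski_closureP; apply. Qed.

Lemma sub_zariski_closure X : X `<=` zariski_closure X.
Proof. by move=> v Xv; apply/zariski_closureP => p; apply. Qed.

Lemma zariski_closed_closure X : zariski_closed (zariski_closure X).
Proof.
exists [set p | vanishes p X].
by apply/seteqP; split=> v /= /zariski_closureP.
Qed.

(** Primality of the vanishing ideal. For the converse, two closed sets not containing [Z] each
    supply an equation that fails on [Z]; the product of these equations vanishes on the union. *)
Lemma zariski_irreducibleP Z :
  zariski_irreducible Z <->
  Z !=set0 /\ forall p q, vanishes (p * q) Z -> vanishes p Z \/ vanishes q Z.
Proof.
split=> -[Z0 irrZ]; split=> //.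
  have cl p : zariski_closed [set w : point | p.@[mxcoord w] = 0].
    exists [set p]; apply/seteqP; split=> w /=; first by move=> pw q ->.
    by apply.
  move=> p q pqZ; case: (irrZ _ _ (cl p) (cl q)); [|by left|by right].
  move=> v /pqZ; rewrite mevalM => /eqP.
  by rewrite mulf_eq0 => /orP[] /eqP; [left|right].
move=> A B [S ->] [T ->] ZAB; apply: contrapT => /not_orP[hA hB].
have sep (U : set poly_on) :
    ~ Z `<=` [set v | forall p, U p -> p.@[mxcoord v] = 0] ->
    exists2 p, U p & ~ vanishes p Z.
  move=> hU; apply: contrapT => hp; apply: hU => v Zv p Up.
  by apply: contrapT => pv; apply: hp; exists p => // /(_ v Zv).
have [p Sp pZ] := sep _ hA; have [q Tq qZ] := sep _ hB.
have [v /ZAB [] hv | //|//] := irrZ p q.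
- by rewrite mevalM hv ?mul0r.
- by rewrite mevalM (hv q) ?mulr0.
Qed.

Lemma vanishes_prod (J : finType) (p : J -> poly_on) Z :
  zariski_irreducible Z -> vanishes (\prod_j p j) Z ->
  exists j, vanishes (p j) Z.
Proof.
move=> /zariski_irreducibleP[[v Zv] primeZ] pZ; apply: contrapT => hp.
suff /(_ pZ) : ~ vanishes (\prod_j p j) Z by [].
apply: (big_rec (fun q => ~ vanishes q Z)) => [/(_ v Zv)|j q _ hq /primeZ[]//].
  by rewrite meval1 => /eqP; rewrite oner_eq0.
by move=> pj; apply: hp; exists j.
Qed.

Lemma closed_in_separate X Z v :
  closed_in X Z -> X v -> ~ Z v -> exists2 p, vanishes p Z & p.@[mxcoord v] != 0.
Proof.
move=> [A [S ->] ->] Xv hv; apply: contrapT => hp; apply: hv; split=> // p Sp.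
apply: contrapT => /eqP pv; apply: hp; exists p => // w [_]; exact.
Qed.

(** Makes images of parameter spaces, which need not be closed, usable as terms of a chain: passing
    to the closure does not change the vanishing ideal, so it stays prime. *)
Lemma irreducible_trace X Y : Y `<=` X -> zariski_irreducible Y ->
  closed_in X (X `&` zariski_closure Y) /\
  zariski_irreducible (X `&` zariski_closure Y).
Proof.
move=> YX /zariski_irreducibleP[[v Yv] primeY]; split.
  by exists (zariski_closure Y) => //; apply: zariski_closed_closure.
have ext p : vanishes p Y -> vanishes p (X `&` zariski_closure Y).
  by move=> /vanishes_closure pY w [_ /pY].
apply/zariski_irreducibleP; split.
  by exists v; split; [apply: YX | apply: sub_zariski_closure].
move=> p q pq; have [w Yw | |] := primeY p q.
- by apply: pq; split; [apply: YX | apply: sub_zariski_closure].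
- by left; apply: ext.
- by right; apply: ext.
Qed.

(** The closure of one point gives a chain of length 0, and a bounded nonempty set of lengths has a
    maximum. *)
Lemma krull_dim_exists X D : X !=set0 ->
  (forall e, irreducible_chain X e -> (e <= D)%N) ->
  exists d, krull_dim X d.
Proof.
move=> [v Xv] bound.
have chain0 : irreducible_chain X 0.
  exists (fun=> X `&` zariski_closure [set v]); split=> // _ _.
  apply: irreducible_trace; first by move=> _ ->.
  apply/zariski_irreducibleP; split; first by exists v.
  move=> p q /(_ v erefl); rewrite mevalM => /eqP.
  by rewrite mulf_eq0 => /orP[] /eqP h; [left|right] => _ ->.
have ex : exists d, `[< irreducible_chain X d >] by exists 0; apply/asboolP.
have ub d : `[< irreducible_chain X d >] -> (d <= D)%N.
  by move=> /asboolP/bound.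
case: (ex_maxnP ex ub) => d /asboolP dX maxd; exists d; split=> // e eX.
by apply: maxd; apply/asboolP.
Qed.

(** * Bounding chains by the number of parameters of a rational map *)

Definition rational_param D (h : {mpoly k[D]})
    (Q : 'I_(r * (n * n)) -> {mpoly k[D]}) (x : 'I_D -> k) (v : point) : Prop :=
  h.@[x] != 0 /\ forall j, (Q j).@[x] = h.@[x] * mxcoord v j.

Section CountingArgument.
Context (D : nat) (h : {mpoly k[D]}) (Q : 'I_(r * (n * n)) -> {mpoly k[D]}).

Let c := maxn (msize h) (\max_j msize (Q j)).

(* The pullback of p along the rational map with coordinates Q j / h becomes a
   polynomial of degree at most d * c once multiplied by h ^+ d. *)
Definition pullback_degree p (d : nat) : Prop :=
  exists2 P : {mpoly k[D]}, (msize P <= (d * c).+1)%N &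
  forall x v, rational_param h Q x v -> P.@[x] = h.@[x] ^+ d * p.@[mxcoord v].

Lemma pullback_degree_const a : pullback_degree a%:MP 0.
Proof.
exists a%:MP; first by rewrite msizeC; case: (_ != _).
by move=> x v _; rewrite !mevalC mul1r.
Qed.

Lemma pullback_degree_var j : pullback_degree 'X_j 1.
Proof.
exists (Q j); last by move=> x v [_ ->]; rewrite mevalXU.
by rewrite mul1n leqW // leq_max orbC (leq_bigmax j).
Qed.

Lemma pullback_degreeM p q d e : pullback_degree p d -> pullback_degree q e ->
  pullback_degree (p * q) (d + e).
Proof.
move=> [P sP hP] [P' sP' hP']; exists (P * P').
  by rewrite mulnDl; apply: msizeM_leS.
move=> x v xv; rewrite !mevalM (hP x v) // (hP' x v) // exprD; ring.
Qed.

(** Extra factors [h] pad the numerator, so that terms of different degrees can share one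
    denominator. *)
Lemma pullback_degree_leq p d e : (d <= e)%N -> pullback_degree p d ->
  pullback_degree p e.
Proof.
move=> /subnK <-; elim: (_ - _)%N => [//|m IH] pd; rewrite addSn.
have [P sP hP] := IH pd; exists (h * P).
  by rewrite mulSn; apply: msizeM_leS => //; rewrite leqW // leq_maxl.
by move=> x v xv; rewrite mevalM (hP x v) // exprS mulrA.
Qed.

Lemma pullback_degreeD p q d : pullback_degree p d -> pullback_degree q d ->
  pullback_degree (p + q) d.
Proof.
move=> [P sP hP] [P' sP' hP']; exists (P + P').
  by apply: leq_trans (msizeD_le _ _) _; rewrite geq_max sP.
by move=> x v xv; rewrite !mevalD (hP x v) // (hP' x v) // mulrDr.
Qed.

Lemma pullback_degreeX p d m : pullback_degree p d ->
  pullback_degree (p ^+ m) (m * d).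
Proof.
move=> pd; elim: m => [|m IH]; first exact: (pullback_degree_const 1).
by rewrite exprS mulSn; apply: pullback_degreeM.
Qed.

Lemma pullback_degree_exists p : exists d, pullback_degree p d.
Proof.
elim/mpolyind: p => [|a m p _ _ [d pd]].
  by exists 0%N; rewrite -mpolyC0; apply: pullback_degree_const.
suff [e me] : exists e, pullback_degree (a *: 'X_[m]) e.
  exists (maxn e d); apply: pullback_degreeD.
    by apply: pullback_degree_leq me; apply: leq_maxl.
  by apply: pullback_degree_leq pd; apply: leq_maxr.
rewrite -mul_mpolyC mpolyXE_id.
apply: (big_rec (fun q => exists e, pullback_degree (a%:MP * q) e)) =>
  [|i q _ [e hq]].
  by exists 0%N; rewrite mulr1; apply: pullback_degree_const.
exists (m i * 1 + e)%N; rewrite mulrCA; apply: pullback_degreeM => //.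
exact/pullback_degreeX/pullback_degree_var.
Qed.

(** The sum is an expansion in base [f]. Restriction to [Z] kills all but the zeroth digit, which is
    therefore 0; the remaining sum is divisible by [f], and [f] cancels because the ideal of [Z'] is
    prime. *)
Lemma vanishes_digits (I : finType) (m : I -> poly_on) f Z Z' s
    (a : nat -> I -> k) :
    (forall b : I -> k, vanishes (\sum_i b i *: m i) Z -> forall i, b i = 0) ->
    zariski_irreducible Z' -> Z `<=` Z' -> vanishes f Z -> ~ vanishes f Z' ->
    vanishes (\sum_(b < s) f ^+ b * \sum_i a b i *: m i) Z' ->
  forall b i, (b < s)%N -> a b i = 0.
Proof.
move=> freeZ /zariski_irreducibleP[_ primeZ'] ZZ' fZ fZ'.
elim: s a => [//|s IH] a; rewrite big_ord_recl expr0 mul1r => hs.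
have fshift : \sum_(b < s) f ^+ lift ord0 b * (\sum_i a (lift ord0 b) i *: m i) =
    f * \sum_(b < s) f ^+ b * \sum_i a b.+1 i *: m i.
  by rewrite mulr_sumr; apply: eq_bigr => b _; rewrite mulrA -exprS.
rewrite fshift in hs.
have a0 : forall i, a 0 i = 0.
  apply: freeZ => v Zv; have := hs v (ZZ' v Zv).
  by rewrite mevalD mevalM (fZ v Zv) mul0r addr0.
rewrite [X in X + _]big1 ?add0r in hs; last by move=> i _; rewrite a0 scale0r.
have {}hs : vanishes (\sum_(b < s) f ^+ b * \sum_i a b.+1 i *: m i) Z'.
  by case: (primeZ' _ _ hs).
by case=> [|b] i //; rewrite ltnS; apply: (IH (fun b => a b.+1)).
Qed.

(** The family consists of the monomials in the [f i] with all exponents at most [s]. Each further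
    link multiplies it by the [s.+1] powers of the new [f e], and independence passes up by
    comparing digits. *)
Lemma chain_free_monomials (Z : nat -> set point) (f : nat -> poly_on) s d e :
    (forall i, (i <= e)%N -> zariski_irreducible (Z i)) ->
    (forall i, (i < e)%N -> Z i `<=` Z i.+1) ->
    (forall i, (i < e)%N -> [/\ vanishes (f i) (Z i), ~ vanishes (f i) (Z i.+1)
       & pullback_degree (f i) d]) ->
  exists (I : finType) (m : I -> poly_on),
    [/\ #|I| = (s.+1 ^ e)%N, forall i, pullback_degree (m i) (e * (s * d))
      & forall a : I -> k,
          vanishes (\sum_i a i *: m i) (Z e) -> forall i, a i = 0].
Proof.
elim: e => [|e IH] irrZ subZ hf.
  exists unit, (fun=> 1); split; first by rewrite card_unit.
    by move=> _; apply: (pullback_degree_const 1).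
  move=> a ha []; have /zariski_irreducibleP[[v Zv] _] := irrZ 0 isT.
  have := ha v Zv; rewrite (big_pred1 tt); last by case.
  by rewrite mevalZ meval1 mulr1.
have [|||I [m [cardI degm freem]]] := IH.
- by move=> i ie; apply/irrZ/leqW.
- by move=> i ie; apply/subZ/leqW.
- by move=> i ie; apply/hf/leqW.
have [fZ fZ' degf] := hf e (ltnSn e).
exists ('I_s.+1 * I)%type, (fun bi : 'I_s.+1 * I => f e ^+ bi.1 * m bi.2); split.
- by rewrite card_prod card_ord cardI expnS.
- move=> [b i] /=; rewrite mulSn; apply: pullback_degreeM => //.
  apply: pullback_degree_leq (pullback_degreeX b degf).
  by rewrite leq_mul2r -ltnS ltn_ord orbT.
move=> a ha [b i].
have /(_ b i (ltn_ord b)) : forall b i, (b < s.+1)%N -> a (inord b, i) = 0.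
  apply: (@vanishes_digits I m (f e) (Z e) (Z e.+1) s.+1
    (fun b i => a (inord b, i))) => //.
  - exact: irrZ.
  - exact: subZ.
  rewrite (_ : \sum_(b < s.+1) _ = \sum_i a i *: (f e ^+ i.1 * m i.2)) //.
  transitivity (\sum_(b < s.+1) \sum_i a (b, i) *: (f e ^+ b * m i)).
    apply: eq_bigr => b' _; rewrite mulr_sumr; apply: eq_bigr => i' _.
    by rewrite inord_val scalerAr.
  by rewrite pair_bigA; apply: eq_bigr => -[].
by rewrite inord_val.
Qed.

End CountingArgument.

(** A monomial of total degree below [C] has all its exponents below [C], so the space containing
    the [P i] has dimension at most [C ^ D]. *)
Lemma mpoly_dependent D C (I : finType) (P : I -> {mpoly k[D]}) :
    (forall i, msize (P i) <= C)%N -> (C ^ D < #|I|)%N ->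
  exists2 a : I -> k, \sum_i a i *: P i = 0 & exists i, a i != 0.
Proof.
move=> sizeP cardI.
pose M := \matrix_(i < #|I|, m < #|{: 'X_{1..D < C}}|)
  (P (enum_val i))@_(enum_val m).
have cardX : (#|{: 'X_{1..D < C}}| <= C ^ D)%N.
  have -> : (C ^ D)%N = #|{ffun 'I_D -> 'I_C}| by rewrite card_ffun !card_ord.
  pose F (m : 'X_{1..D < C}) : {ffun 'I_D -> 'I_C} :=
    [ffun i => Ordinal (leq_ltn_trans (mnm_le_mdeg m i) (bmdeg m))].
  apply: (@leq_card _ _ F) => m1 m2 /ffunP F12; apply/val_inj/mnmP => i.
  by have := F12 i; rewrite !ffunE => -[].
have kerM : kermx M != 0.
  rewrite kermx_eq0 -row_leq_rank -ltnNge.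
  by rewrite (leq_ltn_trans (rank_leq_col M)) // (leq_ltn_trans cardX).
have [u /eqP uM u0] : exists2 u : 'rV_#|I|, u *m M == 0 & u != 0.
  by have [u /sub_kermxP/eqP] := rowV0Pn kerM; exists u.
exists (fun i => u 0 (enum_rank i)); last first.
  by have /rV0Pn[i ui] := u0; exists (enum_val i); rewrite enum_valK.
apply/mpolyP => m; rewrite mcoeff0 raddf_sum /=.
have [ltmC|] := ltnP (mdeg m) C; last first.
  move=> Cm; rewrite big1 // => i _; rewrite mcoeffZ memN_msupp_eq0 ?mulr0 //.
  by apply: msize_mdeg_ge; apply: leq_trans Cm.
have /matrixP/(_ 0 (enum_rank (BMultinom ltmC))) := uM.
rewrite !mxE => {2}<-; rewrite (reindex_onto enum_val enum_rank) /=; last first.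
  by move=> i _; rewrite enum_rankK.
rewrite (eq_bigl xpredT) => [|i]; last by rewrite enum_valK eqxx.
by apply: eq_bigr => i _; rewrite mcoeffZ mxE enum_valK enum_rankK.
Qed.

Lemma exponential_gap A D e :
  (forall s, s.+1 ^ e <= (A * s).+1 ^ D)%N -> (e <= D)%N.
Proof.
move=> hs; rewrite leqNgt; apply/negP => ltDe.
(* With this [s], the right side is at most ((A+1)(s+1))^D = s (s+1)^D, which is less than
   (s+1)^(D+1). *)
have := leq_trans _ (hs (A.+1 ^ D)%N); set s := (A.+1 ^ D)%N => /(_ (s.+1 ^ D.+1)%N).
have s0 : (0 < s)%N by rewrite expn_gt0.
rewrite leq_exp2l // => /(_ ltDe); apply/negP; rewrite -ltnNge.
apply: (@leq_ltn_trans ((A.+1 * s.+1) ^ D)).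
  by case: (D) => [//|D']; rewrite leq_exp2r //; nia.
by rewrite expnMn expnS ltn_pmul2r // expn_gt0.
Qed.

Lemma irreducible_chain_bound (J : finType) D (h : J -> {mpoly k[D]})
    (Q : J -> 'I_(r * (n * n)) -> {mpoly k[D]}) (Y : set point) X :
    (forall v, Y v -> exists j x, rational_param (h j) (Q j) x v) ->
    X `<=` zariski_closure Y ->
  forall e, irreducible_chain X e -> (e <= D)%N.
Proof.
move=> hY XY e [Z [clirrZ ltZ]].
pose Yj j : set point := [set v | exists x, rational_param (h j) (Q j) x v].
have ZX i : (i <= e)%N -> Z i `<=` X.
  by move=> /clirrZ[[A _ ->] _] v [].
(* The top term lies in the closure of a single piece: otherwise the product of one bad polynomial
   per piece vanishes on [Y], hence on [Z e], and by irreducibility so does one of its factors. *)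
have [j Zj] : exists j, forall p, vanishes p (Yj j) -> vanishes p (Z e).
  apply: contrapT => /forallNP hj.
  have /choice[p hp] j : exists p, vanishes p (Yj j) /\ ~ vanishes p (Z e).
    by have /existsNP[p /not_implyP pj] := hj j; exists p.
  have [//||j pj] := @vanishes_prod _ p (Z e).
  - exact: (clirrZ e (leqnn e)).2.
  - move=> v Zv; apply: (vanishes_closure _ (XY v (ZX e (leqnn e) v Zv))).
    move=> w /hY[j [x xw]]; rewrite (bigD1 j) //= mevalM.
    by rewrite (hp j).1 ?mul0r //; exists x.
  - by have [] := hp j.
have /choice[f hf] (i : nat) : exists f, (i < e)%N ->
    vanishes f (Z i) /\ ~ vanishes f (Z i.+1).
  have [ie|] := ltnP i e; last by exists 0.
  have [_ /existsNP[v /not_implyP[Zv Zv']]] := ltZ i ie.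
  have [p pZ pv] := closed_in_separate (clirrZ i (ltnW ie)).1 (ZX i.+1 ie v Zv) Zv'.
  by exists p => _; split=> // /(_ v Zv) /eqP; apply/negP.
have /choice[d hd] i := pullback_degree_exists (h j) (Q j) (f i).
pose d0 := (\max_(i < e) d i)%N.
pose c := maxn (msize (h j)) (\max_i msize (Q j i)).
apply: (@exponential_gap (e * d0 * c)) => s; rewrite leqNgt; apply/negP => lt_s.
have [|||I [m [cardI degm freem]]] := @chain_free_monomials _ (h j) (Q j) Z f s d0 e.
- by move=> i /clirrZ[].
- by move=> i /ltZ[].
- move=> i ie; have [? ?] := hf i ie; split=> //.
  by apply: pullback_degree_leq (hd i); rewrite (leq_bigmax (Ordinal ie)).
have /choice[P hP] i : exists P : {mpoly k[D]},
    (msize P <= (e * (s * d0) * c).+1)%N /\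
    forall x v, rational_param (h j) (Q j) x v ->
      P.@[x] = (h j).@[x] ^+ (e * (s * d0)) * (m i).@[mxcoord v].
  by have [P] := degm i; exists P.
have [|//|a aP [i]] := @mpoly_dependent D (e * (s * d0) * c).+1 I P.
- by move=> i; have [] := hP i.
- by rewrite cardI (_ : e * (s * d0) * c = e * d0 * c * s)%N //; ring.
(* The relation among the pullbacks, divided by the nonzero power of [h j], is a relation among the
   monomials on the image, hence on [Z e], against their independence. *)
rewrite freem ?eqxx //; apply: Zj => v [x xv].
have hx : (h j).@[x] ^+ (e * (s * d0)) != 0 by rewrite expf_neq0 //; case: xv.
apply: (mulfI hx); rewrite mulr0 -(meval0 x) -aP !raddf_sum mulr_sumr /=.
apply: eq_bigr => l _; have [_ Pl] := hP l.
by rewrite !mevalZ (Pl x v) // mulrCA.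
Qed.

End Vanishing.

(** * The centralizer of the Jordan block *)

Section Toeplitz.

(** The polynomial in the Jordan block J with coefficient [c l] at J^l. *)
Definition toeplitz (R : comNzRingType) n (c : nat -> R) : 'M[R]_n.+1 :=
  \matrix_(a, b) if (a <= b)%N then c (b - a)%N else 0.

Context (k : closedFieldType) (n : nat).
Implicit Types (A : 'M[k]_n.+1) (c : nat -> k).
Local Notation J := (jordan_block k n.+1).

Lemma mulmx_shift A a b :
  (A *m J) a b =
  if (b : nat) is b'.+1 then A a (inord b') else 0.
Proof.
rewrite mxE; case: b => -[|b] ltb /=.
  by rewrite big1 // => i _; rewrite mxE mulr0.
rewrite (bigD1 (inord b)) //= big1 ?addr0.
  by rewrite mxE inordK ?eqxx ?mulr1 // ltnW.
move=> i ib; rewrite mxE /= eqSS; case: eqP => [bi|]; last by rewrite mulr0.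
by rewrite bi inord_val eqxx in ib.
Qed.

Lemma shift_mulmx A a b :
  (J *m A) a b =
  if (a.+1 < n.+1)%N then A (inord a.+1) b else 0.
Proof.
rewrite mxE; case: ifP => lta.
  rewrite (bigD1 (inord a.+1)) //= big1 ?addr0.
    by rewrite mxE inordK ?eqxx ?mul1r.
  move=> i ia; rewrite mxE; case: eqP => [ai|]; last by rewrite mul0r.
  by rewrite -ai inord_val eqxx in ia.
rewrite big1 // => i _; rewrite mxE; case: eqP => [ai|]; last by rewrite mul0r.
by rewrite -ai ltn_ord in lta.
Qed.

(** Comparing entries of the two products shows that each row is the previous one shifted right, so
    the first row determines [A]. *)
Lemma commute_shift_toeplitz A :
    A *m J =
      J *m A ->
  A = toeplitz n (fun l => A ord0 (inord l)).
Proof.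
move=> /matrixP AJ.
suff ind a b : (a < n.+1)%N ->
    A (inord a) b = if (a <= b)%N then A ord0 (inord (b - a)) else 0.
  by apply/matrixP => a b; rewrite mxE -ind ?inord_val.
elim: a b => [|a IH] b lta.
  rewrite subn0 inord_val; congr (A _ _); apply: val_inj; exact: inordK.
have := AJ (inord a) b; rewrite shift_mulmx mulmx_shift.
rewrite (inordK (ltnW lta)) lta => <-.
case: b => -[|b] ltb //=; by rewrite IH ?(ltnW lta) // (inordK (ltnW ltb)) subSS.
Qed.

Lemma toeplitz_commute_shift c :
  toeplitz n c *m J =
    J *m toeplitz n c.
Proof.
apply/matrixP => a b; rewrite mulmx_shift shift_mulmx.
case: b => -[|b] ltb /=; first by case: ifP => // lta; rewrite mxE inordK.
case: ifP => lta; rewrite !mxE !inordK ?(ltnW ltb) //.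
by rewrite leqNgt ifN // negbK; move: lta ltb; lia.
Qed.

Lemma det_toeplitz c : \det (toeplitz n c) = c 0 ^+ n.+1.
Proof.
rewrite -det_tr det_trig.
  under eq_bigr do rewrite !mxE leqnn subnn.
  by rewrite prodr_const card_ord.
by apply/is_trig_mxP => i j ij; rewrite !mxE leqNgt ij.
Qed.

Lemma nilpotent_jordan_block : nilpotent_mx J.
Proof.
suff powJ d a b : (J ^+ d) a b = (b == (a + d)%N :> nat)%:R.
  exists n.+1; apply/matrixP => a b; rewrite powJ mxE ltn_eqF //.
  exact: ltn_addl.
elim: d a => [|d IH] a; first by rewrite expr0 mxE addn0 eq_sym.
rewrite exprS -mulmxE shift_mulmx; case: ifP => lta.
  by rewrite IH inordK // addSnnS.
by rewrite ltn_eqF //; move: (ltn_ord b); lia.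
Qed.

End Toeplitz.

(** * Parameters for tuples whose first matrix is regular nilpotent *)

Section RegularParametrization.
Context (n r : nat).

(* The free entries of a matrix with a prescribed last column, and the
   coefficients of J, .., J^n in all but the first matrix of the tuple. *)
Definition regular_index : finType := ('I_n.+1 * 'I_n + 'I_r * 'I_n)%type.

Section Matrices.
Context (R : comNzRingType).
Implicit Types (y : regular_index -> R).

(** The ring is arbitrary so that one formula serves both for polynomials in the parameters and for
    their values. *)
Definition framed_mx (j : 'I_n.+1) y : 'M[R]_n.+1 :=
  \matrix_(a, b) if unlift ord_max b is Some b' then y (inl (a, b'))
                 else (a == j)%:R.

(** The Jordan block itself at index 0, and polynomials in it without constant term at the other
    indices. *)
Definition nilpotent_toeplitz y (q : 'I_r.+1) : 'M[R]_n.+1 :=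
  toeplitz n (fun l =>
    if unlift ord0 q is Some q' then
      if l is l'.+1 then oapp (fun i => y (inr (q', i))) 0 (insub l') else 0
    else (l == 1)%:R).

End Matrices.

Lemma map_framed_mx (R S : comNzRingType) (f : {rmorphism R -> S}) j y :
  map_mx f (framed_mx j y) = framed_mx j (f \o y).
Proof.
by apply/matrixP => a b; rewrite !mxE; case: unlift => //; rewrite rmorph_nat.
Qed.

Lemma map_nilpotent_toeplitz (R S : comNzRingType) (f : {rmorphism R -> S}) y q :
  map_mx f (nilpotent_toeplitz y q) = nilpotent_toeplitz (f \o y) q.
Proof.
apply/matrixP => a b; rewrite !mxE; case: ifP => _; last by rewrite rmorph0.
case: unlift => [q'|]; last by rewrite rmorph_nat.
by case: (_ - _)%N => [|l]; [|case: insub => [i|]//=]; rewrite ?rmorph0.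
Qed.

Context (k : closedFieldType).

Lemma regular_tuple_param (v : mxtuple k n.+1 r.+1) :
    commuting_nilpotent v -> regular_nilpotent (v ord0) ->
  exists j (y : regular_index -> k), framed_mx j y \in unitmx /\
    forall q, v q *m framed_mx j y = framed_mx j y *m nilpotent_toeplitz y q.
Proof.
move=> [nilv commv] [g gu v0].
pose w := invmx g; have wu : w \in unitmx by rewrite unitmx_inv.
(* This entry will be the diagonal of the Toeplitz matrix [t], which makes [t] invertible. *)
have [j wj] : exists j, w ord_max j != 0.
  apply: contrapT => /forallNP hw; have /matrixP/(_ ord_max ord_max) := mulVmx gu.
  rewrite !mxE eqxx big1 => [/eqP|i _]; first by rewrite eq_sym oner_eq0.
  by have /negP/negPn/eqP -> := hw i; rewrite mul0r.
(* Multiplying g by an element of the centralizer k[J] of J makes its last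
   column the standard vector e_j. *)
pose t : 'M[k]_n.+1 := toeplitz n (fun l => w (inord (n - l)) j).
have tu : t \in unitmx.
  rewrite unitmxE unitfE det_toeplitz expf_neq0 // subn0.
  by rewrite (_ : inord n = ord_max) //; apply: val_inj; rewrite /= inordK.
pose G := g *m t; have Gu : G \in unitmx by rewrite unitmx_mul gu.
(* The last column of [t] is column [j] of the inverse of [g]. *)
have Gj a : G a ord_max = (a == j)%:R.
  have /matrixP/(_ a j) := mulmxV gu; rewrite !mxE => <-.
  apply: eq_bigr => i _; rewrite mxE leq_ord subKn ?leq_ord //.
  by rewrite inord_val.
have GJ : v ord0 *m G = G *m jordan_block k n.+1.
  by rewrite v0 /G -!mulmxA mulKmx // toeplitz_commute_shift ?mulmxA.
clearbody G.
pose A q := invmx G *m v q *m G.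
have GA q : v q *m G = G *m A q by rewrite /A -!mulmxA mulKVmx.
have A0 : A ord0 = jordan_block k n.+1 by rewrite /A -mulmxA GJ mulKmx.
have AJ q : A q *m jordan_block k n.+1 = jordan_block k n.+1 *m A q.
  rewrite -A0 /A -!mulmxA !(mulKVmx Gu); congr (_ *m _); rewrite !mulmxA.
  by congr (_ *m _); apply/eqP; rewrite -subr_eq0 commv.
clearbody A.
have At q := commute_shift_toeplitz (AJ q).
have inord0 : inord 0 = ord0 :> 'I_n.+1 by apply: val_inj; rewrite /= inordK.
(* The determinant of [A q] is a power of its diagonal entry, and nilpotency makes it 0. *)
have nilA q : A q ord0 ord0 = 0.
  have [d vd] := nilv q.
  have powA e : v q ^+ e *m G = G *m A q ^+ e.
    elim: e => [|e IH]; first by rewrite !expr0 mulmx1 mul1mx.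
    by rewrite !exprS -!mulmxE -[LHS]mulmxA IH mulmxA GA mulmxA.
  have detX e : \det (A q ^+ e) = \det (A q) ^+ e.
    by elim: e => [|e IH]; rewrite ?det1 // !exprS -IH -mulmxE det_mulmx.
  have : A q ^+ d = 0 by rewrite -[LHS](mulKmx Gu) -powA vd mul0mx mulmx0.
  move=> /(congr1 determinant); rewrite det0 detX [in \det _]At det_toeplitz inord0.
  by rewrite -exprM => /eqP; rewrite expf_eq0 => /andP[_ /eqP].
pose y (p : regular_index) : k := match p with
  | inl ab => G ab.1 (lift ord_max ab.2)
  | inr ql => A (lift ord0 ql.1) ord0 (lift ord0 ql.2)
  end.
have GE : framed_mx j y = G.
  apply/matrixP => a b; rewrite mxE.
  by case: unliftP => [b'|] ->.
exists j, y; rewrite GE; split=> // q; rewrite GA; congr (_ *m _).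
apply/matrixP => a b; rewrite mxE; case: unliftP => [q'|] ->; last first.
  rewrite A0 mxE; case: leqP => ab.
    by congr (_%:R); move: (nat_of_ord a) (nat_of_ord b) ab => {a b} a b; lia.
  by rewrite ltn_eqF // ltnW.
rewrite At mxE; case: leqP => // ab; case: (posnP (b - a)) => [->|].
  rewrite -[RHS](nilA (lift ord0 q')); congr (A _ _ _).
  by apply: val_inj; rewrite /= inordK.
case ba: (b - a)%N => [//|l] _; have ltl : (l < n)%N by move: (ltn_ord b); lia.
rewrite insubT /=; congr (A _ _ _).
by apply: val_inj; rewrite /= inordK.
Qed.

Let D := #|regular_index|.
Let X : regular_index -> {mpoly k[D]} := fun p => 'X_(enum_rank p).

Lemma regular_closure_bound e :
  irreducible_chain (regular_closure k n.+1 r.+1) e ->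
  (e <= n.+1 * n + r * n)%N.
Proof.
have <- : #|regular_index| = (n.+1 * n + r * n)%N.
  by rewrite card_sum !card_prod !card_ord.
pose frame j := framed_mx j X.
(* One rational map for each position [j] of the frame; the adjugate replaces the inverse, leaving
   the determinant as denominator. *)
apply: (irreducible_chain_bound (h := fun j => \det (frame j))
  (Q := fun j l => mxvec (\matrix_(q < r.+1)
     mxvec (frame j *m nilpotent_toeplitz X q *m \adj (frame j))) 0 l)
  _ (@subset_refl _ _)).
move=> v [nilv [i i0 regv]]; have {i0} i0 : i = ord0 by apply: val_inj.
rewrite i0 in regv; have [j [y [Gu vG]]] := regular_tuple_param nilv regv.
exists j, (fun i => y (enum_val i)); set x := fun i => y (enum_val i).
have Xx : meval x \o X =1 y by move=> p; rewrite /= mevalXU /x enum_rankK.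
have frameE : map_mx (meval x) (frame j) = framed_mx j y.
  by rewrite map_framed_mx; apply/matrixP => a b; rewrite !mxE; case: unlift.
have toepE q : map_mx (meval x) (nilpotent_toeplitz X q) = nilpotent_toeplitz y q.
  by rewrite map_nilpotent_toeplitz (funext Xx).
have detE : (\det (frame j)).@[x] = \det (framed_mx j y).
  by rewrite -frameE det_map_mx.
split=> [|l]; rewrite detE; first by rewrite -unitfE -unitmxE.
have -> (M : 'M_(r.+1, n.+1 * n.+1)) :
    (mxvec M 0 l).@[x] = mxvec (map_mx (meval x) M) 0 l.
  by rewrite -map_mxvec mxE.
have -> : \det (framed_mx j y) * mxcoord v l =
    mxvec (\det (framed_mx j y) *: \matrix_q mxvec (v q)) 0 l.
  by rewrite linearZ !mxE.
congr (mxvec _ 0 l); apply/row_matrixP => q; rewrite linearZ /= -map_row !rowK.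
rewrite map_mxvec -linearZ /= !map_mxM /= map_mx_adj frameE toepE.
by rewrite -vG -mulmxA mul_mx_adj mul_mx_scalar.
Qed.

End RegularParametrization.

(** * A long chain in V_P from a coordinate flag *)

Section Flag.
Context (k : closedFieldType) (n1 m r : nat).
Local Notation D := (n1 * m + r.+1 * (m * n1))%N.
Local Notation point := (mxtuple k (n1 + m) r.+1).

Section Matrices.
Context (R : comNzRingType).
Implicit Types (A : 'M[R]_(m, n1)) (B : 'M[R]_(n1, m)) (y : 'rV[R]_D).

Definition conj_block B A : 'M[R]_(n1 + m) :=
  block_mx (B *m A) (- (B *m A *m B)) A (- (A *m B)).

Lemma conj_blockE B A :
  conj_block B A =
    block_mx 1%:M B 0 1%:M *m block_mx 0 0 A 0 *m block_mx 1%:M (- B) 0 1%:M.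
Proof.
rewrite !mulmx_block !(mulmx0, mul0mx, mulmx1, mul1mx, mulmxN, add0r, addr0).
by [].
Qed.

Definition flag_B y : 'M[R]_(n1, m) := vec_mx (lsubmx y).

Definition flag_A y (q : 'I_r.+1) : 'M[R]_(m, n1) :=
  vec_mx (row q (vec_mx (rsubmx y))).

Definition flag_mx y q : 'M[R]_(n1 + m) := conj_block (flag_B y) (flag_A y q).

End Matrices.

Lemma map_flag_mx (R S : comNzRingType) (f : {rmorphism R -> S}) (y : 'rV[R]_D) q :
  map_mx f (flag_mx y q) = flag_mx (map_mx f y) q.
Proof.
have BE : map_mx f (flag_B y) = flag_B (map_mx f y).
  by rewrite map_vec_mx map_lsubmx.
have AE : map_mx f (flag_A y q) = flag_A (map_mx f y) q.
  by rewrite map_vec_mx map_row map_vec_mx map_rsubmx.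
by rewrite map_block_mx !map_mxN !map_mxM BE AE.
Qed.

Definition flag_tuple (y : 'rV[k]_D) : point := [ffun q => flag_mx y q].

(* The first A-block is the identity padded with a zero column if n1 = m + 1, so
   that the top left block of the first matrix displays B. *)
Definition flag_base : 'rV[k]_D :=
  row_mx 0 (mxvec (\matrix_q if q == ord0 then mxvec (pid_mx m) else 0)).

(* The i-dimensional affine subspaces of a flag through the base point; the
   entries of B are freed first, then those of the A-blocks. *)
Definition flag_step (i : nat) : set 'rV[k]_D :=
  [set y | forall l : 'I_D, (i <= l)%N -> y 0 l = flag_base 0 l].

(** While entries of B are being freed, the first A-block is still the padded identity, so the top
    left block of the first matrix shows B. The lower left blocks always show the A-blocks. *)
Lemma flag_coordinate (l : 'I_D) : (m <= n1)%N ->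
  exists q a b, forall y, flag_step l.+1 y -> flag_tuple y q a b = y 0 l.
Proof.
move=> mn1; case: (split_ordP l) => l' ->.
  case/mxvec_indexP: l' => a b.
  exists ord0, (lshift m a), (lshift m (widen_ord mn1 b)) => y yl.
  have -> : y 0 (lshift _ (mxvec_index a b)) = flag_B y a b by rewrite !mxE.
  have A0 : flag_A y ord0 = pid_mx m.
    apply/matrixP => c d.
    have -> : flag_A y ord0 c d =
        y 0 (rshift _ (mxvec_index ord0 (mxvec_index c d))).
      by rewrite !mxE.
    rewrite yl; last exact: (ltn_addr _ (ltn_ord (mxvec_index a b))).
    by rewrite row_mxEr mxvecE mxE eqxx mxvecE.
  rewrite ffunE block_mxEul A0 mxE (bigD1 b) //= big1 ?addr0.
    by rewrite [pid_mx _ _ _]mxE /= eqxx ltn_ord mulr1.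
  move=> i ib; rewrite [pid_mx _ _ _]mxE /=.
  by move: ib; rewrite -val_eqE /= => /negbTE ->; rewrite mulr0.
case/mxvec_indexP: l' => q l'; case/mxvec_indexP: l' => a b.
exists q, (rshift n1 a), (lshift m b) => y _.
by rewrite ffunE block_mxEdl !mxE.
Qed.

Lemma flag_tuple_V_P y : ((n1 + m)./2 = m)%N -> V_P k (n1 + m) r.+1 (flag_tuple y).
Proof.
move=> half; pose g : 'M[k]_(n1 + m) := block_mx 1%:M (flag_B y) 0 1%:M.
pose g' : 'M[k]_(n1 + m) := block_mx 1%:M (- flag_B y) 0 1%:M.
have gg' : g *m g' = 1%:M.
  rewrite mulmx_block !(mulmx0, mul0mx, mulmx1, mul1mx, add0r, addr0).
  by rewrite addNr -scalar_mx_block.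
have gu : g \in unitmx by case: (mulmx1_unit gg').
exists g => //; exists [ffun q => block_mx 0 0 (flag_A y q) 0].
  move=> q i j; rewrite ffunE half addnK.
  case: (split_ordP i) => i' ->; case: (split_ordP j) => j' ->.
  - by rewrite block_mxEul mxE.
  - by rewrite block_mxEur mxE.
  - by case/negP; apply/andP; split; [exact: leq_addr | ].
  - by rewrite block_mxEdr mxE.
move=> q; rewrite !ffunE /flag_mx conj_blockE -/g; congr (_ *m _).
by rewrite -[RHS]mulmx1 -gg' mulKmx.
Qed.

Lemma horner_meval N (c : 'I_N -> {poly k}) (p : {mpoly k[N]}) :
  exists P : {poly k}, forall t, P.[t] = p.@[fun j => (c j).[t]].
Proof.
elim/mpolyind: p => [|a mm p _ _ [P hP]].
  by exists 0 => t; rewrite meval0 horner0.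
exists (a *: \prod_j c j ^+ mm j + P) => t.
rewrite mevalD mevalZ mevalX hornerD hornerZ horner_prod hP.
by under eq_bigr do rewrite horner_exp.
Qed.

(** If neither [p] nor [q] vanishes on the image, join a witness for each by a line inside the
    affine subspace. Both restrict to nonzero polynomials in one variable, and some parameter is a
    root of neither. *)
Lemma flag_step_irreducible i : zariski_irreducible (flag_tuple @` flag_step i).
Proof.
apply/zariski_irreducibleP; split.
  by exists (flag_tuple flag_base); exists flag_base => // l.
move=> p q pq; apply: contrapT => /not_orP[/not_vanishes[_ [y yi <-] py]].
move=> /not_vanishes[_ [z zi <-] qz].
pose line (t : k) := y + t *: (z - y).
have line_i t : flag_step i (line t).
  move=> l il; have -> : line t 0 l = y 0 l + t * (z 0 l - y 0 l) by rewrite !mxE.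
  by rewrite (yi l il) (zi l il) subrr mulr0 addr0.
have lineP (f : {mpoly k[r.+1 * ((n1 + m) * (n1 + m))]}) :
    exists P : {poly k}, forall t, P.[t] = f.@[mxcoord (flag_tuple (line t))].
  (* The generic point of the line; evaluating its variable at [t] gives [line t]. *)
  pose Y : 'rV[{poly k}]_D := map_mx polyC y + 'X *: map_mx polyC (z - y).
  have [P hP] :=
    horner_meval (fun j => mxvec (\matrix_q0 mxvec (flag_mx Y q0)) 0 j) f.
  exists P => t; rewrite hP; apply: meval_eq => j; rewrite /mxcoord.
  have -> (M : 'M[{poly k}]_(r.+1, (n1 + m) * (n1 + m))) :
      (mxvec M 0 j).[t] = mxvec (map_mx (horner_eval t) M) 0 j.
    by rewrite -map_mxvec mxE.
  congr (mxvec _ 0 j); apply/row_matrixP => q0.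
  rewrite -map_row !rowK map_mxvec map_flag_mx ffunE.
  rewrite [map_mx _ Y](_ : _ = line t) //.
  by apply/rowP => l; rewrite !mxE /= /horner_eval hornerD hornerM hornerX !hornerC.
have [P hP] := lineP p; have [Q hQ] := lineP q.
have line0 : line 0 = y by rewrite /line scale0r addr0.
have line1 : line 1 = z by rewrite /line scale1r addrC subrK.
have P0 : P != 0.
  by apply: contraNneq py => P0; rewrite -line0 -hP P0 horner0.
have Q0 : Q != 0.
  by apply: contraNneq qz => Q0; rewrite -line1 -hQ Q0 horner0.
have /closed_nonrootP[t] : P * Q != 0 by rewrite mulf_neq0.
rewrite rootE hornerM hP hQ -mevalM pq ?eqxx //.
by exists (line t).
Qed.

Lemma V_P_chain : (m <= n1)%N -> ((n1 + m)./2 = m)%N ->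
  irreducible_chain (V_P k (n1 + m) r.+1) D.
Proof.
move=> mn1 half.
have sub i : flag_tuple @` flag_step i `<=` V_P k (n1 + m) r.+1.
  by move=> _ [y _ <-]; apply: flag_tuple_V_P.
exists (fun i =>
  V_P k (n1 + m) r.+1 `&` zariski_closure (flag_tuple @` flag_step i)).
split=> i iD; first exact/irreducible_trace/flag_step_irreducible.
split=> [v [Vv iv]|].
  split=> //; apply/zariski_closureP => p pi1; move/zariski_closureP: iv; apply.
  move=> _ [y yi <-]; apply: pi1; exists y => // l il; exact/yi/ltnW.
pose l := Ordinal iD.
have [q [a [b qab]]] := flag_coordinate l mn1.
(* Strictness: this point moves the newly freed coordinate off its base value, while the matrix
   entry displaying that coordinate is constant on the smaller term. *)
pose y := flag_base + delta_mx 0 l.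
have yi : flag_step i.+1 y.
  move=> l' il'; rewrite mxE [delta_mx _ _ _ _]mxE [l' == l]gtn_eqF ?andbF ?addr0 //.
move=> /(_ (flag_tuple y))[].
  by split; [apply: flag_tuple_V_P | apply: sub_zariski_closure; exists y].
move=> _ /zariski_closureP.
move=> /(_ ('X_(mxvec_index q (mxvec_index a b)) - (flag_base 0 l)%:MP)).
have coordE z : flag_step i.+1 z ->
    ('X_(mxvec_index q (mxvec_index a b)) - (flag_base 0 l)%:MP).@[
      mxcoord (flag_tuple z)]
    = z 0 l - flag_base 0 l.
  by move=> zi; rewrite mevalB mevalXU mevalC /mxcoord mxvecE mxE mxvecE qab.
have yl : y 0 l = flag_base 0 l + 1 by rewrite mxE [delta_mx _ _ _ _]mxE !eqxx.
rewrite coordE // yl addrAC subrr add0r => h.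
have /eqP := oner_neq0 k; apply; apply: h.
move=> _ [z zi <-]; rewrite coordE; first by rewrite zi ?subrr.
by move=> l' il'; apply/zi/ltnW.
Qed.

End Flag.

(** * Comparison of the two dimensions *)

Lemma dimension_gap n r m a :
    n.+1 = (a + m)%N -> (a = m) \/ (a = m.+1) ->
    (3 < n.+1)%N /\ (6 <= r.+1)%N \/ (7 < n.+1)%N /\ (3 < r.+1)%N ->
  (n.+1 * n + r * n < a * m + r.+1 * (m * a))%N.
Proof.
move=> nE am hnr.
have [p [q mr]] : exists p q, (m = p + 2 /\ r = q + 5 \/ m = p + 4 /\ r = q + 3)%N.
  by case: hnr => hnr;
    [exists (m - 2)%N, (r - 5)%N|exists (m - 4)%N, (r - 3)%N]; lia.
case: am mr => aE [] [mE rE]; subst a m r.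
- have -> : n = (2 * p + 3)%N by lia. nia.
- have -> : n = (2 * p + 7)%N by lia. nia.
- have -> : n = (2 * p + 4)%N by lia. nia.
- have -> : n = (2 * p + 8)%N by lia. nia.
Qed.

Theorem theorem4p1p2 (k : closedFieldType) (n r : nat)
    (hnr : (3 < n)%N /\ (6 <= r)%N \/ (7 < n)%N /\ (3 < r)%N) :
  exists dV dN : nat,
    [/\ krull_dim (V_P k n r) dV,
        krull_dim (regular_closure k n r) dN
      & (dN < dV)%N].
Proof.
case: n r hnr => [|n] [|r] hnr; try by case: hnr => -[].
have hm : (n.+1./2 <= n.+1 - n.+1./2)%N by lia.
have nE : (n.+1 - n.+1./2 + n.+1./2 = n.+1)%N by lia.
have := @V_P_chain k (n.+1 - n.+1./2) n.+1./2 r hm; rewrite nE => /(_ erefl) chainV.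
(* A crude bound by the dimension of the ambient space, parametrized by its own coordinates; it
   ensures that the dimension of V_P exists. *)
have boundV e : irreducible_chain (V_P k n.+1 r.+1) e ->
    (e <= r.+1 * (n.+1 * n.+1))%N.
  apply: (irreducible_chain_bound (J := unit) (h := fun=> 1)
    (Q := fun=> mpolyX k \o mnm1) (Y := setT)).
    move=> v _; exists tt, (mxcoord v); rewrite /rational_param meval1 oner_eq0.
    by split=> // j; rewrite mul1r mevalXU.
  by move=> v _; apply: sub_zariski_closure.
have nonempty X d : irreducible_chain (X : set (mxtuple k n.+1 r.+1)) d -> X !=set0.
  move=> [Z [/(_ 0 isT)[[A _ ->] [[v [Xv _]] _]] _]]; by exists v.
have [dV hdV] := krull_dim_exists (nonempty _ _ chainV) boundV.
have [|dN hdN] := krull_dim_exists _ (@regular_closure_bound n r k).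
  (* The constant tuple of Jordan blocks shows that the closure is nonempty. *)
  exists [ffun=> jordan_block k n.+1]; apply: sub_zariski_closure; split; last first.
    exists ord0 => //; exists 1%:M; first exact: unitmx1.
    by rewrite ffunE mul1mx invmx1 mulmx1.
  split=> [i|i j]; rewrite !ffunE ?subrr //.
  exact: nilpotent_jordan_block.
exists dV, dN; split=> //.
apply: leq_ltn_trans (regular_closure_bound hdN.1) _.
apply: leq_trans (hdV.2 _ chainV).
by apply: dimension_gap hnr; lia.
Qed.
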